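(* Given two spectral density functions $f_0,f_1$, extremal (geodesic) paths $f_\tau$ ($\tau\in[0,1]$) connecting the two, in the sense of achieving a local extremal of the path integral $\ell(f_\tau:0,1)$, must satisfy, for $x_\tau=\log f_\tau$, $$\frac{\dot{x}_\tau(\theta)-\left(\frac{1}{2\pi}\int_{-\pi}^{\pi}\dot{x}_\tau(\theta)\,d\theta\right)}{\sqrt{\frac{1}{2\pi}\int_{-\pi}^{\pi}\left(\dot{x}_\tau(\theta)\right)^2d\theta-\left(\frac{1}{2\pi}\int_{-\pi}^{\pi}\dot{x}_\tau(\theta)\,d\theta\right)^2}}=v(\theta),$$ i.e., the left hand side must be independent of $\tau$.
   Context: Spectral density functions are taken in the set $\mathcal{F}$ of functions $f$ that are differentiable on $[-\pi,\pi]$, with $f(\theta)>0$, and with both $f(\theta)$ and $df(\theta)/d\theta$ square integrable; throughout, all functions are assumed smooth enough so that the indicated integrals exist. A path $f_\tau$, $\tau\in[0,1]$, of spectral density functions connecting $f_0$ and $f_1$ is a function $f_\tau(\theta)$ of the path parameter $\tau$ and the frequency $\theta$; a dot denotes the derivative with respect to $\tau$, e.g. $\dot f_\tau(\theta):=\partial f_\tau(\theta)/\partial\tau$, so that $\dot x_\tau=\dot f_\tau/f_\tau$. The length of the path is $$\ell(f_\tau:0,1):=\int_0^1\sqrt{\delta(f_\tau,f_{\tau+d\tau})}=\int_0^1\sqrt{\frac{1}{2\pi}\int_{-\pi}^{\pi}\left(\frac{\dot f_\tau(\theta)}{f_\tau(\theta)}\right)^2d\theta-\left(\frac{1}{2\pi}\int_{-\pi}^{\pi}\frac{\dot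 f_\tau(\theta)}{f_\tau(\theta)}\,d\theta\right)^2}\;d\tau,$$ where $\delta(f,g):=\log\left(\frac{1}{2\pi}\int_{-\pi}^{\pi}\frac{f(\theta)}{g(\theta)}\,d\theta\right)+\log\left(\frac{1}{2\pi}\int_{-\pi}^{\pi}\frac{g(\theta)}{f(\theta)}\,d\theta\right)$ and higher order terms in $d\tau$ are dropped. *)

(* Defs.v *)
From HB Require Import structures.
From mathcomp Require Import all_boot all_order all_algebra.
From mathcomp Require Import all_classical all_reals all_analysis.

Set Implicit Arguments.
Unset Strict Implicit.
Unset Printing Implicit Defensive.

Import Order.TTheory GRing.Theory Num.Theory.
Import numFieldNormedType.Exports.

Local Open Scope classical_set_scope.
Local Open Scope ring_scope.

Section Derivative_within.
Variable R : realType.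
Implicit Types (A : set R) (g : R -> R) (x : R).

(* Derivatives relative to a set A; the quotients only use the values of g
   on A, so that they are one-sided at the endpoints of a closed interval. *)
Definition quotient_within A g x : set_system R :=
  ((y - x)^-1 * (g y - g x)) @[y --> within A x^'].

Definition derivable_within A g x : Prop := cvg (quotient_within A g x).

(* Unspecified unless [derivable_within A g x]. *)
Definition derive_within A g x : R := lim (quotient_within A g x).

End Derivative_within.

Section Spectral_densities.
Variable R : realType.
Implicit Types (g : R -> R) (f h : R -> R -> R).

Definition freqs : set R := `[- pi, pi].

Definition times : set R := `[0, 1].

Definition square_integrable (g : R -> R) : Prop :=
  measurable_fun freqs g /\
  lebesgue_measure.-integrable freqs (EFin \o (fun t => g t ^+ 2)).

Definition differentiable_L2 (g : R -> R) : Prop :=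
  [/\ forall t, freqs t -> derivable_within freqs g t,
      square_integrable g
    & square_integrable (derive_within freqs g)].

(* The class of spectral densities; the values of g outside [-pi, pi] are
   irrelevant. *)
Definition spectral_density (g : R -> R) : Prop :=
  differentiable_L2 g /\ (forall t, freqs t -> 0 < g t).

(* Families [f tau theta]: first the path parameter, then the frequency. *)
Definition dtau (f : R -> R -> R) (tau theta : R) : R :=
  derive_within times (fun s => f s theta) tau.

Definition jointly_continuous (f : R -> R -> R) : Prop :=
  {within times `*` freqs, continuous (fun p : R * R => f p.1 p.2)}.

(* The smoothness asked of a family in the path parameter: it is C^1 in tau,
   jointly with theta. *)
Definition smooth_family (f : R -> R -> R) : Prop :=
  [/\ forall tau theta, times tau -> freqs theta ->
        derivable_within times (fun s => f s theta) tau,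
      jointly_continuous f
    & jointly_continuous (dtau f)].

Definition path_between (f0 f1 : R -> R) (f : R -> R -> R) : Prop :=
  [/\ smooth_family f,
      forall tau, times tau -> spectral_density (f tau),
      forall theta, freqs theta -> f 0 theta = f0 theta
    & forall theta, freqs theta -> f 1 theta = f1 theta].

Definition mean (g : R -> R) : R :=
  (2 * pi)^-1 * \int[lebesgue_measure]_(theta in freqs) g theta.

Definition deviation (g : R -> R) : R :=
  Num.sqrt (mean (fun theta => g theta ^+ 2) - mean g ^+ 2).

(* With delta f g := ln (mean (f / g)) + ln (mean (g / f)), the leading term of
   delta (f tau) (f (tau + dtau)) is (deviation (f' / f))^2 dtau^2, where f' is
   the derivative of f in tau; the length of a path integrates its square
   root. *)
Definition path_length (f : R -> R -> R) : R :=
  \int[lebesgue_measure]_(tau in times)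
    deviation (fun theta => dtau f tau theta / f tau theta).

(* The C^1 neighbourhoods of weak extrema in the calculus of variations. They
   are smaller than the uniform ones, so that a local extremum for the uniform
   distance is also one here. *)
Definition C1_close (e : R) (f h : R -> R -> R) : Prop :=
  forall tau theta, times tau -> freqs theta ->
    `|h tau theta - f tau theta| < e /\
    `|dtau h tau theta - dtau f tau theta| < e.

Definition local_minimum (f0 f1 : R -> R) (f : R -> R -> R) : Prop :=
  exists2 e : R, 0 < e & forall h, path_between f0 f1 h -> C1_close e f h ->
    path_length f <= path_length h.

Definition local_maximum (f0 f1 : R -> R) (f : R -> R -> R) : Prop :=
  exists2 e : R, 0 < e & forall h, path_between f0 f1 h -> C1_close e f h ->
    path_length h <= path_length f.

(* Variations keeping the endpoints fixed. Positivity of [f + e h] on the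
   compact set [0, 1] x [-pi, pi] is automatic for small e. *)
Definition admissible_variation (h : R -> R -> R) : Prop :=
  [/\ smooth_family h,
      forall tau, times tau -> differentiable_L2 (h tau),
      forall theta, freqs theta -> h 0 theta = 0
    & forall theta, freqs theta -> h 1 theta = 0].

Definition stationary (f : R -> R -> R) : Prop :=
  forall h, admissible_variation h ->
    is_derive (0 : R) 1
      (fun e : R => path_length (fun tau theta => f tau theta + e * h tau theta))
      0.

(* "Extremal" covers both of its usual meanings: a local extremum of the
   length, and a path at which the first variation of the length vanishes. A
   local extremum need not be stationary, as the length need not be
   differentiable at a path whose speed vanishes somewhere. *)
Definition extremal_path (f0 f1 : R -> R) (f : R -> R -> R) : Prop :=
  path_between f0 f1 f /\
  [\/ local_minimum f0 f1 f, local_maximum f0 f1 f | stationary f].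

Definition log_path (f : R -> R -> R) : R -> R -> R :=
  fun tau theta => ln (f tau theta).

End Spectral_densities.

Arguments freqs {R}.
Arguments times {R}.

(* Main.v *)
(* Put A = dtau f / f, the speed of log f. The variation f (1 + e Psi(tau)
   phi(theta)), with Psi vanishing at both ends and psi = Psi', has speed
   A + e psi phi / (1 + e Psi phi). When the deviation of A is bounded away from
   0 on the support of psi, the length of the varied path is, up to O(e^2), the
   length of f plus e times
     int_0^1 psi(tau) cov(A_tau, phi) / deviation(A_tau) dtau,
   so this integral vanishes for a local minimum, a local maximum and a
   stationary path alike. Now compare two times t1, t2 at which A has nonzero
   deviation, and let psi be a tent near t1 minus a tent near t2: the deviation
   may vanish between t1 and t2, where psi = 0. As in the lemma of du
   Bois-Reymond, cov(A_tau, phi) / deviation(A_tau) takes the same value at t1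
   and t2, and letting phi range over bump functions shows that the normalized
   speeds at t1 and t2 are equal. *)
Require Import Defs.
From HB Require Import structures.
From mathcomp Require Import all_boot all_order all_algebra.
From mathcomp Require Import all_classical all_reals all_analysis.
From mathcomp Require Import measurable_realfun ring lra.

Set Implicit Arguments.
Unset Strict Implicit.
Unset Printing Implicit Defensive.

Import Order.TTheory GRing.Theory Num.Theory.
Import numFieldNormedType.Exports.

Local Open Scope classical_set_scope.
Local Open Scope ring_scope.

(** * Means and covariances over the frequencies *)

Section Mean.
Context {R : realType}.
Implicit Types (g h : R -> R).

Lemma pi2_gt0 : 0 < 2 * pi :> R.
Proof. by rewrite mulr_gt0 ?pi_gt0. Qed.

Lemma continuous_itv_integrable (a b : R) g : continuous g ->
  lebesgue_measure.-integrable `[a, b] (EFin \o g).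
Proof.
move=> cg; apply: continuous_compact_integrable; first exact: segment_compact.
exact: continuous_subspaceT.
Qed.

Lemma mean_integrable g : continuous g ->
  lebesgue_measure.-integrable freqs (EFin \o g).
Proof. exact: continuous_itv_integrable. Qed.

Lemma measurable_freqs : measurable (freqs : set R).
Proof. exact: measurable_itv. Qed.
Hint Resolve measurable_freqs : core.

Lemma eq_mean g h : (forall x, freqs x -> g x = h x) -> mean g = mean h.
Proof.
by move=> gh; congr (_ * _); apply: eq_Rintegral => x /set_mem; exact: gh.
Qed.

Lemma meanD g h : continuous g -> continuous h ->
  mean (fun x => g x + h x) = mean g + mean h.
Proof.
move=> cg ch; rewrite /mean RintegralD//; first by rewrite mulrDr.
- exact: mean_integrable.
- exact: mean_integrable.
Qed.

Lemma meanZ (r : R) g : continuous g -> mean (fun x => r * g x) = r * mean g.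
Proof.
move=> cg; rewrite /mean RintegralZl//; first by rewrite mulrCA.
exact: mean_integrable.
Qed.

Lemma mean_cst (r : R) : mean (fun=> r) = r.
Proof.
rewrite /mean Rintegral_cst// /freqs /= lebesgue_measure_itv/= lte_fin.
rewrite gtrN ?pi_gt0//= opprK -mulr2n -[pi *+ 2]mulr_natl.
by rewrite mulrCA mulVf ?mulr1// gt_eqF// pi2_gt0.
Qed.

Lemma le_mean g h : continuous g -> continuous h ->
  (forall x, freqs x -> g x <= h x) -> mean g <= mean h.
Proof.
move=> cg ch gh; rewrite ler_pM2l ?invr_gt0 ?pi2_gt0//.
apply: le_Rintegral => //; exact: mean_integrable.
Qed.

Lemma norm_mean_le (M : R) g : continuous g ->
  (forall x, freqs x -> `|g x| <= M) -> `|mean g| <= M.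
Proof.
move=> cg gM; rewrite ler_norml; apply/andP; split.
- rewrite -[leLHS]mean_cst; apply: le_mean => //; first by move=> x; exact: cvg_cst.
  by move=> x /gM; rewrite ler_norml => /andP[].
- rewrite -[leRHS]mean_cst; apply: le_mean => //; first by move=> x; exact: cvg_cst.
  by move=> x /gM; rewrite ler_norml => /andP[].
Qed.

Definition cov g h : R := mean (fun x => g x * h x) - mean g * mean h.

Lemma continuous_mul g h : continuous g -> continuous h ->
  continuous (fun x => g x * h x).
Proof. by move=> cg ch x; apply: cvgM; [exact: cg|exact: ch]. Qed.

Lemma continuous_add g h : continuous g -> continuous h ->
  continuous (fun x => g x + h x).
Proof. by move=> cg ch x; apply: cvgD; [exact: cg|exact: ch]. Qed.

Lemma continuous_scale r g : continuous g -> continuous (fun x => r * g x).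
Proof. by move=> cg x; apply: cvgM; [exact: cvg_cst|exact: cg]. Qed.

Lemma covC g h : cov g h = cov h g.
Proof. by rewrite /cov [mean h * _]mulrC; congr (_ - _); apply: eq_mean => x _; rewrite mulrC. Qed.

Lemma eq_cov g g' h h' : (forall x, freqs x -> g x = g' x) ->
  (forall x, freqs x -> h x = h' x) -> cov g h = cov g' h'.
Proof.
move=> gg' hh'; rewrite /cov (eq_mean gg') (eq_mean hh'); congr (_ - _).
by apply: eq_mean => x xf; rewrite gg'// hh'.
Qed.

Lemma covDr g h k : continuous g -> continuous h -> continuous k ->
  cov g (fun x => h x + k x) = cov g h + cov g k.
Proof.
move=> cg ch ck; rewrite /cov meanD//.
under eq_mean do rewrite mulrDr.
by rewrite meanD; [ring|exact: continuous_mul..].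
Qed.

Lemma covZr r g h : continuous g -> continuous h ->
  cov g (fun x => r * h x) = r * cov g h.
Proof.
move=> cg ch; rewrite /cov meanZ//.
under eq_mean do rewrite mulrCA.
by rewrite meanZ; [ring|exact: continuous_mul].
Qed.

(** Bilinearity. Together with [sqr_deviation] it turns the deviation of a perturbed function into
    the square root of a perturbed square. *)
Lemma covDZ e g h : continuous g -> continuous h ->
  cov (fun x => g x + e * h x) (fun x => g x + e * h x) =
  cov g g + 2 * e * cov g h + e ^+ 2 * cov h h.
Proof.
move=> cg ch.
have ceh : continuous (fun x => e * h x) by exact: continuous_scale.
have cgeh := continuous_add cg ceh.
rewrite covDr// (covC _ g) (covC (fun x => g x + e * h x)) !covDr//.
by rewrite (covC (fun x => e * h x) g) !covZr// (covC (fun x => e * h x)) covZr//; ring.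
Qed.

(** The covariance of [g] with itself is the mean of the square of [g x - mean g]. *)
Lemma cov_ge0 g : continuous g -> 0 <= cov g g.
Proof.
move=> cg; set m := mean g.
have cgm : continuous (fun x => g x - m).
  by move=> x; apply: cvgB; [exact: cg|exact: cvg_cst].
suff -> : cov g g = mean (fun x => (g x - m) * (g x - m)).
  by rewrite mulr_ge0 ?invr_ge0 ?(ltW pi2_gt0)// Rintegral_ge0// => x _; rewrite -expr2 sqr_ge0.
have -> : mean (fun x => (g x - m) * (g x - m)) =
  mean (fun x => g x * g x + (- (2 * m) * g x + m ^+ 2)).
  by apply: eq_mean => x _; ring.
rewrite meanD; first last.
- by apply: continuous_add; [exact: continuous_scale|move=> x; exact: cvg_cst].
- exact: continuous_mul.
rewrite meanD ?mean_cst ?meanZ//; first last.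
- by move=> x; exact: cvg_cst.
- exact: continuous_scale.
by rewrite /cov -/m; ring.
Qed.

Lemma deviationE g : deviation g = Num.sqrt (cov g g).
Proof. by []. Qed.

Lemma sqr_deviation g : continuous g -> deviation g ^+ 2 = cov g g.
Proof. by move=> cg; rewrite deviationE sqr_sqrtr// cov_ge0. Qed.

Lemma norm_cov_le (M N : R) g h : continuous g -> continuous h ->
  (forall x, freqs x -> `|g x| <= M) -> (forall x, freqs x -> `|h x| <= N) ->
  `|cov g h| <= 2 * M * N.
Proof.
move=> cg ch gM hN.
have -> : 2 * M * N = M * N + M * N by ring.
rewrite (le_trans (ler_normB _ _))// lerD//.
- apply: norm_mean_le; first exact: continuous_mul.
  by move=> x xf; rewrite normrM ler_pM// ?gM ?hN.
- by rewrite normrM ler_pM// norm_mean_le.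
Qed.

End Mean.

Section Sqrt.
Context {R : realType}.

(** With [s] the root, [t = (s - N) * (s + N)] and the remainder is exactly
    [- (s - N) ^+ 2 / (2 * N)]. The bound is this quantity, up to sign, times [((s + N) / N) ^+ 2],
    a factor at least 1; no smallness of [t] enters. *)
Lemma sqrt_expansion (N t : R) : 0 < N -> 0 <= N ^+ 2 + t ->
  `|Num.sqrt (N ^+ 2 + t) - N - t / (2 * N)| <= t ^+ 2 / (2 * N ^+ 3).
Proof.
move=> N0 Nt; set s := Num.sqrt _.
have s0 : 0 <= s by rewrite sqrtr_ge0.
have -> : t = s ^+ 2 - N ^+ 2 by rewrite sqr_sqrtr//; ring.
have Nn : N != 0 by rewrite gt_eqF.
have -> : s - N - (s ^+ 2 - N ^+ 2) / (2 * N) = - ((s - N) ^+ 2 / (2 * N)).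
  by field.
rewrite normrN ger0_norm; last by rewrite divr_ge0 ?sqr_ge0// mulr_ge0// ltW.
have -> : (s ^+ 2 - N ^+ 2) ^+ 2 / (2 * N ^+ 3) =
  (s - N) ^+ 2 / (2 * N) * ((s + N) / N) ^+ 2 by field.
rewrite ler_peMr//; first by rewrite divr_ge0 ?sqr_ge0// mulr_ge0// ltW.
by rewrite expr_ge1// ?divr_ge0 ?addr_ge0 ?(ltW N0)// ler_pdivlMr// mul1r lerDr.
Qed.

End Sqrt.

(** * Continuity in the path parameter *)

Section Parametric_mean.
Context {R : realType}.
Implicit Types (F G : R -> R -> R).

(** Continuity on the whole plane rather than within the rectangle, so that slices are continuous
    outright; [clamped] reduces the general case to this one. *)
Definition plane_continuous F := continuous (fun p : R * R => F p.1 p.2).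

Lemma plane_continuous_slice F t : plane_continuous F -> continuous (F t).
Proof.
move=> cF x; apply: (@continuous_comp _ _ _ (fun y => (t, y)) (fun p => F p.1 p.2)).
  exact: (cvg_pair (cvg_cst _) cvg_id).
exact: cF.
Qed.

Lemma plane_continuous_fst g : continuous g -> plane_continuous (fun t _ => g t).
Proof.
by move=> cg p; apply: (@continuous_comp _ _ _ fst g); [exact: cvg_fst|exact: cg].
Qed.

Lemma plane_continuous_snd g : continuous g -> plane_continuous (fun _ x => g x).
Proof.
by move=> cg p; apply: (@continuous_comp _ _ _ snd g); [exact: cvg_snd|exact: cg].
Qed.

Lemma plane_continuousM F G : plane_continuous F -> plane_continuous G ->
  plane_continuous (fun t x => F t x * G t x).
Proof. by move=> cF cG p; apply: cvgM; [exact: cF|exact: cG]. Qed.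

Lemma plane_continuousD F G : plane_continuous F -> plane_continuous G ->
  plane_continuous (fun t x => F t x + G t x).
Proof. by move=> cF cG p; apply: cvgD; [exact: cF|exact: cG]. Qed.

Lemma plane_continuousV F : plane_continuous F -> (forall t x, F t x != 0) ->
  plane_continuous (fun t x => (F t x)^-1).
Proof. by move=> cF F0 p; apply: cvgV; [exact: F0|exact: cF]. Qed.

Lemma plane_continuousZ e F : plane_continuous F ->
  plane_continuous (fun t x => e * F t x).
Proof. by move=> cF p; apply: cvgM; [exact: cvg_cst|exact: cF]. Qed.

(** Compactness of [freqs] makes [F s] uniformly close to [F t] over the frequencies when [s] is
    near [t], and the mean is bounded by the uniform norm. *)
Lemma continuous_mean F : plane_continuous F -> continuous (fun t => mean (F t)).
Proof.
move=> cF t; apply/cvgrPdist_le => e e0.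
have /compact_near_coveringP cov_freqs : compact (freqs : set R).
  exact: segment_compact.
have near_uniform : \forall s \near t, freqs `<=` (fun x => `|F t x - F s x| <= e).
  apply: (cov_freqs _ (nbhs t) (fun s x => `|F t x - F s x| <= e)) => x xf.
  (* For [y] near [x] and [s] near [t], both [F t y] and [F s y] lie within [e / 2] of [F t x]. *)
  have e20 : 0 < e / 2 by rewrite divr_gt0.
  have /cvgrPdist_le/(_ _ e20) cFx := cF (t, x).
  have cFt : \forall y \near x, `|F t x - F t y| <= e / 2.
    by have /cvgrPdist_le/(_ _ e20) := @plane_continuous_slice F t cF x.
  have [[/= U V] [Ut Vx] UVF] := cFx.
  exists (V `&` (fun y => `|F t x - F t y| <= e / 2), U).
    by split => //; exact: filterI.
  case=> y s /= [[Vy Fy] Us].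
  have /= Fs := UVF (s, y) (conj Us Vy).
  by move: Fs Fy; rewrite !ler_norml; move=> /andP[? ?] /andP[? ?]; apply/andP; split; lra.
near=> s.
have cFB : continuous (fun x => F t x + -1 * F s x).
  by apply: continuous_add; [|apply: continuous_scale]; exact: plane_continuous_slice.
have -> : mean (F t) - mean (F s) = mean (fun x => F t x + -1 * F s x).
  rewrite meanD ?meanZ ?mulN1r//; try exact: plane_continuous_slice.
  by apply: continuous_scale; exact: plane_continuous_slice.
apply: norm_mean_le => // x xf; rewrite mulN1r.
by have : freqs `<=` (fun x => `|F t x - F s x| <= e); [near: s|exact].
Unshelve. all: end_near. Qed.

Lemma continuous_cov F G : plane_continuous F -> plane_continuous G ->
  continuous (fun t => cov (F t) (G t)).
Proof.
move=> cF cG t; apply: cvgB.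
  by apply: (@continuous_mean (fun t x => F t x * G t x)); exact: plane_continuousM.
by apply: cvgM; apply: continuous_mean.
Qed.

Lemma continuous_deviation F : plane_continuous F ->
  continuous (fun t => deviation (F t)).
Proof.
move=> cF t; apply: (@continuous_comp _ _ _ (fun t => cov (F t) (F t)) Num.sqrt).
  exact: continuous_cov.
exact: sqrt_continuous.
Qed.

Lemma jointly_continuous_bounded F : jointly_continuous F ->
  exists2 M, 0 < M & forall t x, times t -> freqs x -> `|F t x| <= M.
Proof.
move=> cF.
have : compact ((fun p : R * R => F p.1 p.2) @` (times `*` freqs)).
  apply: continuous_compact; first exact: cF.
  by apply: compact_setX; exact: segment_compact.
(* Boundedness provides a bound at every number above [M]; this one is also positive. *)
move=> /compact_bounded[M [_ /(_ (Num.max 0 M + 1))]] bM.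
exists (Num.max 0 M + 1).
  by rewrite ltr_wpDl// le_max lexx.
move=> t x tt xf; apply: bM.
  by rewrite (@le_lt_trans _ _ (Num.max 0 M))// ?le_max ?lexx ?orbT// ltrDl.
by exists (t, x).
Qed.

Lemma plane_continuous_bounded F : plane_continuous F ->
  exists2 M, 0 < M & forall t x, times t -> freqs x -> `|F t x| <= M.
Proof. by move=> cF; apply/jointly_continuous_bounded/continuous_subspaceT. Qed.

End Parametric_mean.

(** * The first variation of the length *)

Section First_variation.
Context {R : realType}.

(** Applied to the factor [1 + e * (Psi t * phi x)]: it keeps the varied densities positive and the
    denominators in the varied speed away from 0. *)
Lemma multiplier_ge (e s u : R) : `|e| <= 1 / 2 -> `|s| <= 1 -> `|u| <= 1 ->
  1 / 2 <= 1 + e * (s * u).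
Proof.
move=> e2 s1 u1.
have : `|e * (s * u)| <= 1 / 2.
  rewrite normrM -[leRHS]mulr1 ler_pM// normrM.
  by rewrite -[leRHS]mulr1 ler_pM.
by rewrite ler_norml => /andP[? ?]; lra.
Qed.

(* Truncating the deviation at n0 changes nothing when p != 0, and makes the
   coefficient of e continuous in the path parameter. *)
Lemma deviation_expansion (M P n0 e p s : R) (a phi : R -> R) :
  continuous a -> continuous phi ->
  (forall x, freqs x -> `|a x| <= M) -> (forall x, `|phi x| <= 1) ->
  `|p| <= P -> `|s| <= 1 -> `|e| <= 1 / 2 ->
  0 < n0 -> (p != 0 -> n0 <= deviation a) ->
  `|deviation (fun x => a x + e * (p * phi x / (1 + e * (s * phi x))))
    - deviation a - e * (p * (cov a phi / Num.max n0 (deviation a)))| <=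
  ((4 * P * M + 4 * P ^+ 2) / n0 + (8 * M * P + 4 * P ^+ 2) ^+ 2 / (2 * n0 ^+ 3))
    * e ^+ 2.
Proof.
move=> ca cphi aM phi1 pP s1 e2 n0_gt0 n0N.
have M0 : 0 <= M.
  apply: (le_trans _ (aM 0 _)) => //=.
  by rewrite /freqs/= in_itv/= oppr_le0 pi_ge0.
have P0 : 0 <= P by exact: le_trans pP.
have C0 : 0 <= (4 * P * M + 4 * P ^+ 2) / n0
    + (8 * M * P + 4 * P ^+ 2) ^+ 2 / (2 * n0 ^+ 3).
  by rewrite addr_ge0// divr_ge0 ?sqr_ge0 ?addr_ge0 ?mulr_ge0 ?exprn_ge0 // ltW.
(* Where [p = 0] the function [a] is not varied and the left side is 0; only elsewhere is the
   deviation known to be at least [n0]. *)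
have [p0|p_neq0] := eqVneq p 0.
  rewrite p0 (_ : (fun x => _) = a); last by apply/funext => x; rewrite !mul0r mulr0 addr0.
  by rewrite subrr mul0r mulr0 subr0 normr0 mulr_ge0// sqr_ge0.
have {}n0N := n0N p_neq0.
have N_gt0 : 0 < deviation a by exact: lt_le_trans n0N.
rewrite max_r//.
set d := fun x => 1 + e * (s * phi x).
have d2 x : 1 / 2 <= d x by exact: multiplier_ge.
have d0 x : d x != 0 by rewrite gt_eqF// (lt_le_trans _ (d2 x)).
have cd : continuous d.
  move=> x; apply: cvgD; first exact: cvg_cst.
  by apply: (continuous_scale (continuous_scale cphi)).
have cdV : continuous (fun x => (d x)^-1).
  by move=> x; apply: cvgV; [exact: d0|exact: cd].
have dV2 x : `|(d x)^-1| <= 2.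
  rewrite normfV ger0_norm; last by rewrite (le_trans _ (d2 x))// divr_ge0.
  by rewrite -[leRHS]invrK lef_pV2 ?posrE ?invr_gt0// ?(lt_le_trans _ (d2 x))// -div1r.
(* From [1 / d = 1 - e * s * phi / d], the perturbation [q] is [p * phi] up to the term
   [e * p * s * w] of first order in [e]. *)
set w := fun x => phi x * phi x * (d x)^-1.
have cw : continuous w by exact: continuous_mul (continuous_mul cphi cphi) cdV.
have w2 x : `|w x| <= 2.
  rewrite /w normrM -[leRHS]mul1r ler_pM// normrM -[leRHS]mulr1.
  by rewrite ler_pM.
set q := fun x => p * phi x / d x.
have cq : continuous q by exact: continuous_mul (continuous_scale cphi) cdV.
have qE : q = fun x => p * phi x + - (e * p * s) * w x.
  by apply/funext => x; rewrite /q /w /d; field; exact: d0.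
have q2 x : `|q x| <= 2 * P.
  rewrite /q normrM mulrC ler_pM// normrM -[leRHS]mulr1.
  by rewrite ler_pM.
(* The increment of the squared deviation, to be fed to [sqrt_expansion]. *)
set t := 2 * e * cov a q + e ^+ 2 * cov q q.
have devE : deviation (fun x => a x + e * q x) = Num.sqrt (deviation a ^+ 2 + t).
  by rewrite deviationE covDZ// sqr_deviation// addrA.
have covqE : cov a q = p * cov a phi - e * p * s * cov a w.
  rewrite qE covDr ?covZr ?mulNr//; exact: continuous_scale.
have caq : `|cov a q| <= 4 * M * P.
  by rewrite (le_trans (norm_cov_le ca cq aM (fun x _ => q2 x)))//; lra.
have cqq : `|cov q q| <= 8 * P ^+ 2.
  rewrite (le_trans (norm_cov_le cq cq (fun x _ => q2 x) (fun x _ => q2 x)))//.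
  by rewrite le_eqVlt; apply/orP; left; apply/eqP; ring.
have caw : `|cov a w| <= 4 * M.
  by rewrite (le_trans (norm_cov_le ca cw aM (fun x _ => w2 x)))//; lra.
(* The bound [1 / 2] on the size of [e] absorbs one factor of the quadratic term, so that [t ^+ 2]
   is of order [e ^+ 2]. *)
have ct : `|t| <= (8 * M * P + 4 * P ^+ 2) * `|e|.
  rewrite /t (le_trans (ler_normD _ _))// [leRHS]mulrDl lerD//.
    have -> : 8 * M * P * `|e| = 2 * `|e| * (4 * M * P) by ring.
    by rewrite !normrM ger0_norm// ler_wpM2l// mulr_ge0.
  rewrite normrM normrX.
  have -> : 4 * P ^+ 2 * `|e| = (`|e| * (1 / 2)) * (8 * P ^+ 2) by field.
  by rewrite ler_pM// ?sqr_ge0// expr2 ler_wpM2l.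
have Nt : 0 <= deviation a ^+ 2 + t.
  rewrite sqr_deviation// addrA -covDZ//; apply: cov_ge0.
  by apply: continuous_add => //; exact: continuous_scale.
have := sqrt_expansion N_gt0 Nt; rewrite -devE => expansion.
set D := deviation (fun x => a x + e * q x) in expansion *.
set N := deviation a in n0N N_gt0 expansion *.
(* Two errors of order [e ^+ 2]: the remainder of the square root, which gives the second summand of
   the constant, and what [t / (2 * N)] contains beyond its linear part, which gives the first. *)
have -> : D - N - e * (p * (cov a phi / N)) =
   (D - N - t / (2 * N)) + (e ^+ 2 * (cov q q / 2 - p * s * cov a w)) / N.
  by rewrite /t covqE; field; rewrite gt_eqF.
rewrite (le_trans (ler_normD _ _))// addrC [leRHS]mulrDl lerD//.
  have NV : `|N^-1| <= n0^-1.
    by rewrite normfV gtr0_norm// lef_pV2.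
  rewrite normrM [leRHS]mulrAC ler_pM// normrM normrX real_normK ?num_real// mulrC.
  rewrite ler_wpM2r ?sqr_ge0// (le_trans (ler_normB _ _))// addrC lerD//.
    by rewrite normrM [4 * P]mulrC -mulrA ler_pM// normrM -[leRHS]mulr1 ler_pM.
  by rewrite normrM [X in _ * X]ger0_norm ?invr_ge0//; lra.
apply: (le_trans expansion).
rewrite [leRHS]mulrAC ler_pM ?sqr_ge0 ?invr_ge0 ?mulr_ge0 ?exprn_ge0 ?(ltW N_gt0)//.
  rewrite -[X in X <= _]real_normK ?num_real// -[e ^+ 2]real_normK ?num_real// -exprMn.
  by rewrite lerXn2r ?nnegrE// mulr_ge0// addr_ge0// ?mulr_ge0// sqr_ge0.
rewrite lef_pV2 ?posrE ?mulr_gt0 ?exprn_gt0//.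
by rewrite ler_wpM2l// lerXn2r ?nnegrE ?(ltW n0_gt0) ?(ltW N_gt0).
Qed.

End First_variation.

(** * Expansion of the length, and vanishing of its linear term *)

Section Length_expansion.
Context {R : realType}.

Lemma norm_Rintegral_times_le (M : R) (g : R -> R) : continuous g ->
  (forall t, times t -> `|g t| <= M) ->
  `|\int[lebesgue_measure]_(t in times) g t| <= M.
Proof.
move=> cg gM.
have ig := @continuous_itv_integrable R 0 1 g cg.
have -> : M = \int[lebesgue_measure]_(t in times) M.
  rewrite Rintegral_cst; last exact: measurable_itv.
  by rewrite /times /= lebesgue_measure_itv/= lte_fin ltr01/= oppr0 addr0 mulr1.
apply: (@le_trans _ _ (\int[lebesgue_measure]_(t in times) `|g t|)).
  by apply: le_normr_Rintegral => //; exact: measurable_itv.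
apply: le_Rintegral => //; first exact: measurable_itv.
  apply: continuous_itv_integrable => t.
  by apply: (@continuous_comp _ _ _ g); [exact: cg|exact: norm_continuous].
by apply: continuous_itv_integrable => t; exact: cvg_cst.
Qed.

(** Integrates [deviation_expansion] over [times]: its constant depends only on [n0] and on uniform
    bounds for [A] and [psi], hence neither on [t] nor on [e]. *)
Lemma first_variation (A : R -> R -> R) (phi psi Psi : R -> R) (n0 : R) :
  plane_continuous A -> continuous phi -> continuous psi -> continuous Psi ->
  (forall x, `|phi x| <= 1) -> (forall t, `|Psi t| <= 1) -> 0 < n0 ->
  (forall t, times t -> psi t != 0 -> n0 <= deviation (A t)) ->
  exists C, forall e, `|e| <= 1 / 2 ->
  `|\int[lebesgue_measure]_(t in times)
      deviation (fun x => A t x + e * (psi t * phi x / (1 + e * (Psi t * phi x))))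
    - \int[lebesgue_measure]_(t in times) deviation (A t)
    - e * \int[lebesgue_measure]_(t in times)
            (psi t * (cov (A t) phi / Num.max n0 (deviation (A t))))|
  <= C * e ^+ 2.
Proof.
move=> cA cphi cpsi cPsi phi1 Psi1 n0_gt0 n0N.
have [M _ AM] := plane_continuous_bounded cA.
have [P _ psiP] := plane_continuous_bounded (plane_continuous_fst cpsi).
(* The bound on [psi] comes from a statement about functions of two variables, so some frequency is
   needed to read it off. *)
have zero_freq : freqs (0 : R).
  by rewrite /freqs/= in_itv/= oppr_le0 pi_ge0.
exists ((4 * P * M + 4 * P ^+ 2) / n0
  + (8 * M * P + 4 * P ^+ 2) ^+ 2 / (2 * n0 ^+ 3)) => e e2.
have cN : continuous (fun t => deviation (A t)) by exact: continuous_deviation.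
have cV : continuous (fun t => deviation
    (fun x => A t x + e * (psi t * phi x / (1 + e * (Psi t * phi x))))).
  apply: continuous_deviation; apply: plane_continuousD => //.
  apply: plane_continuousZ; apply: plane_continuousM.
    by apply: plane_continuousM; [exact: plane_continuous_fst|exact: plane_continuous_snd].
  apply: plane_continuousV => [|t x]; last first.
    by rewrite gt_eqF// (lt_le_trans _ (multiplier_ge e2 (Psi1 t) (phi1 x))).
  apply: plane_continuousD; first by move=> ?; exact: cvg_cst.
  by apply: plane_continuousZ; apply: plane_continuousM;
    [exact: plane_continuous_fst|exact: plane_continuous_snd].
have cI : continuous (fun t => psi t * (cov (A t) phi / Num.max n0 (deviation (A t)))).
  apply: continuous_mul => //; apply: continuous_mul.
    by apply: (continuous_cov cA); exact: plane_continuous_snd.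
  move=> t; apply: cvgV; first by rewrite gt_eqF// lt_max n0_gt0.
  by apply: (@continuous_max _ _ (fun=> n0) _ t); [exact: cvg_cst|exact: cN].
rewrite -RintegralB; [|exact: measurable_itv|exact: continuous_itv_integrable..].
rewrite -RintegralZl; [|exact: measurable_itv|exact: continuous_itv_integrable].
rewrite -RintegralB; first last.
- by apply: continuous_itv_integrable; exact: continuous_scale.
- by apply: continuous_itv_integrable => t; apply: cvgB; [exact: cV|exact: cN].
- exact: measurable_itv.
apply: norm_Rintegral_times_le.
  by move=> t; apply: cvgB; [apply: cvgB; [exact: cV|exact: cN]|exact: (continuous_scale cI)].
move=> t tt; apply: deviation_expansion => //.
- exact: plane_continuous_slice.
- by move=> x xf; exact: AM.
- exact: (psiP t 0).
- exact: n0N.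
Qed.

(** Along [e = - t * I] with small [t > 0] the linear term lowers [L] by [t * I ^+ 2], while the
    error is at most [C * t ^+ 2 * I ^+ 2]; a nonzero [I] would take [L] below [L 0]. *)
Lemma expansion_min (L : R -> R) (I C : R) :
  (forall e, `|e| <= 1 / 2 -> `|L e - L 0 - e * I| <= C * e ^+ 2) ->
  (\forall e \near 0, L 0 <= L e) -> I = 0.
Proof.
move=> LI Lmin; apply: contrapT => /eqP I0.
(* The estimate at [e = 1 / 2] bounds a norm by a positive multiple of [C]. *)
have C0 : 0 <= C.
  have := LI (1 / 2); rewrite ger0_norm// => /(_ (lexx _)) /(le_trans (normr_ge0 _)).
  by rewrite pmulr_lge0// exprn_gt0.
have I2 : 0 < I ^+ 2 by rewrite exprn_even_gt0.
have near_scaled : \forall t \near 0^'+, L 0 <= L (- t * I) /\ `|- t * I| <= 1 / 2.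
  have c0 : (- t * I) @[t --> (0:R)] --> (0:R).
    rewrite -[X in _ --> X](mul0r I) -[X in X * I]oppr0.
    by apply: cvgM; [apply: cvgN; exact: cvg_id|exact: cvg_cst].
  have : \forall t \near (0:R), L 0 <= L (- t * I) /\ `|- t * I| <= 1 / 2.
    near=> t; split; near: t.
      exact: c0 Lmin.
    move/cvgrPdist_le : c0 => /(_ (1/2)); rewrite divr_gt0// => /(_ isT).
    by apply: filterS => t; rewrite sub0r normrN.
  exact: cvg_within.
have : \forall t \near (0:R)^'+, False.
  near=> t.
  have t0 : 0 < t by [].
  have [Lt tI] : L 0 <= L (- t * I) /\ `|- t * I| <= 1 / 2 by near: t.
  have := LI _ tI; rewrite ler_norml => /andP[_].
  have tC : t * (C + 1) < 1.
    rewrite -ltr_pdivlMr ?ltr_wpDl//; near: t; apply: nbhs_right_lt.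
    by rewrite divr_gt0// ltr_wpDl.
  have : 0 < t * I ^+ 2 * (1 - t * C).
    apply: mulr_gt0; first exact: mulr_gt0.
    by rewrite subr_gt0 (le_lt_trans _ tC)// ler_wpM2l ?(ltW t0)// lerDl.
  have -> : C * (- t * I) ^+ 2 = t * I ^+ 2 * (t * C) by ring.
  nra.
by move=> /filter_ex[].
Unshelve. all: end_near. Qed.

Lemma expansion_max (L : R -> R) (I C : R) :
  (forall e, `|e| <= 1 / 2 -> `|L e - L 0 - e * I| <= C * e ^+ 2) ->
  (\forall e \near 0, L e <= L 0) -> I = 0.
Proof.
move=> LI Lmax; apply/eqP; rewrite -oppr_eq0; apply/eqP.
apply: (@expansion_min (fun e => - L e) _ C) => [e e2|].
  rewrite (_ : _ - _ - _ = - (L e - L 0 - e * I)) ?normrN ?LI//; ring.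
by apply: filterS Lmax => e; rewrite lerN2.
Qed.

(** The quadratic error makes [I] the derivative of [L] at 0, and limits are unique. *)
Lemma expansion_stationary (L : R -> R) (I C : R) :
  (forall e, `|e| <= 1 / 2 -> `|L e - L 0 - e * I| <= C * e ^+ 2) ->
  is_derive (0 : R) 1 L 0 -> I = 0.
Proof.
move=> LI [dL DL].
have C0 : 0 <= C.
  have := LI (1 / 2); rewrite ger0_norm// => /(_ (lexx _)) /(le_trans (normr_ge0 _)).
  by rewrite pmulr_lge0// exprn_gt0.
have LtoI : h^-1 *: ((L \o shift (0:R)) (h *: (1:R)) - L 0) @[h --> (0:R)^'] --> I.
  apply/cvgrPdist_le => e e0; near=> h.
  have h0 : h != 0 by near: h; exact: nbhs_dnbhs_neq.
  have h2 : `|h| <= 1 / 2 by near: h; apply: dnbhs0_le.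
  rewrite /= scaler1 addr0.
  have -> : I - h^-1 *: (L h - L 0) = - (h^-1 * (L h - L 0 - h * I)).
    by rewrite /GRing.scale/=; field.
  rewrite normrN normrM (le_trans (ler_wpM2l _ (LI _ h2)))//.
  rewrite normfV mulrC ler_pdivrMr ?normr_gt0//.
  rewrite -[h ^+ 2]real_normK ?num_real// expr2 mulrA ler_wpM2r//.
  rewrite (le_trans (_ : _ <= (C + 1) * `|h|))//; first by rewrite ler_wpM2r// lerDl.
  rewrite mulrC -ler_pdivlMr ?ltr_wpDl//; near: h; apply: dnbhs0_le.
  by rewrite divr_gt0// ltr_wpDl.
by rewrite -(cvg_lim (@norm_hausdorff _ _) LtoI).
Unshelve. all: end_near. Qed.

End Length_expansion.

(** * Test functions and fundamental lemmas *)

Section Test_functions.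
Context {R : realType}.

(** If [g x] were positive, [g] would stay above [g x / 2] on a nondegenerate interval inside
    [[a, b]], and the integral would be positive. *)
Lemma Rintegral_eq0_continuous (a b : R) (g : R -> R) : a < b -> continuous g ->
  (forall x, `[a, b]%classic x -> 0 <= g x) ->
  \int[lebesgue_measure]_(x in `[a, b]) g x = 0 ->
  forall x, `[a, b]%classic x -> g x = 0.
Proof.
move=> ab cg g0 ig x xab; apply/eqP; rewrite eq_le g0// andbT leNgt.
apply/negP => gx.
have gx2 : 0 < g x / 2 by rewrite divr_gt0.
have /cvgrPdist_lt/(_ _ gx2)/nbhs_ballP[d /= d0 gd] := cg x.
(* The point [x] may be an endpoint: the interval extends to its right, or to its left when [x] is
   [b]. *)
have [u [v [uv uvab uvd]]] : exists u v : R, [/\ u < v, `[u, v] `<=` `[a, b] &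
    forall y, `[u, v]%classic y -> `|x - y| < d].
  move: xab; rewrite /= in_itv/= => /andP[ax xb].
  have [xltb|] := ltP x b.
    exists x, (Num.min b (x + d / 2)); split.
    - by rewrite lt_min xltb ltrDl divr_gt0.
    - move=> y /=; rewrite !in_itv/= le_min => /and3P[xy yb _].
      by rewrite (le_trans ax xy).
    - move=> y /=; rewrite in_itv/= le_min => /and3P[xy _ yd].
      by rewrite distrC ger0_norm ?subr_ge0//; lra.
  move=> bx; exists (Num.max a (x - d / 2)), x; split.
  - by rewrite gt_max (lt_le_trans ab bx)/=; lra.
  - move=> y /=; rewrite !in_itv/= ge_max => /andP[/andP[ay _] yx].
    by rewrite ay (le_trans yx xb).
  - move=> y /=; rewrite in_itv/= ge_max => /andP[/andP[_ yd] yx].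
    by rewrite ger0_norm ?subr_ge0//; lra.
have iab := @continuous_itv_integrable R a b g cg.
have : (0 < \int[lebesgue_measure]_(x in `[a, b]) (g x)%:E)%E.
  apply: (@lt_le_trans _ _ (\int[lebesgue_measure]_(y in `[u, v]) (g x / 2)%:E)%E).
    by rewrite integral_cst//= lebesgue_measure_itv/= lte_fin uv mule_gt0// lte_fin// subr_gt0.
  apply: (@le_trans _ _ (\int[lebesgue_measure]_(y in `[u, v]) (g y)%:E)%E).
    apply: ge0_le_integral => //.
    - by move=> y _; rewrite lee_fin ltW.
    - have := measurable_int lebesgue_measure (@continuous_itv_integrable R u v g cg); exact.
    - move=> y yuv; rewrite lee_fin.
      have /= := gd y (uvd y yuv).
      by rewrite ltr_norml => /andP[_]; lra.
  apply: ge0_subset_integral => //.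
  by have := measurable_int lebesgue_measure iab; exact.
have := integrable_fin_num _ iab; rewrite /Rintegral in ig.
move=> /(_ (measurable_itv _)) /fineK <-.
by rewrite ig ltxx.
Qed.

(** The square of the positive part is C^1, so test functions built from it need no gluing of
    pieces. *)
Definition ramp (t : R) : R := Num.max t 0.

Lemma ramp_cases t : (0 <= t /\ ramp t = t) \/ (t <= 0 /\ ramp t = 0).
Proof.
rewrite /ramp; have [t0|t0] := leP t 0; first by right.
by left; rewrite ltW.
Qed.

Lemma continuous_ramp : continuous ramp.
Proof.
by move=> t; apply: (@continuous_max _ _ id (fun=> 0)); [exact: cvg_id|exact: cvg_cst].
Qed.

Lemma is_derive_ramp_sqr (t : R) : is_derive t 1 (fun t => ramp t ^+ 2) (2 * ramp t).
Proof.
have H : h^-1 *: (((fun t => ramp t ^+ 2) \o shift t) (h *: (1:R)) - ramp t ^+ 2)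
    @[h --> (0:R)^'] --> 2 * ramp t.
  apply/cvgrPdist_le => e e0; near=> h.
  have h0 : h != 0 by near: h; exact: nbhs_dnbhs_neq.
  rewrite /= scaler1 /GRing.scale/=.
  have -> : 2 * ramp t - h^-1 * (ramp (h + t) ^+ 2 - ramp t ^+ 2) =
    - (h^-1 * (ramp (h + t) ^+ 2 - ramp t ^+ 2 - 2 * ramp t * h)) by field.
  rewrite normrN normrM normfV mulrC ler_pdivrMr ?normr_gt0//.
  (* In each of the four sign cases the first-order remainder is at most [h ^+ 2]. *)
  apply: (@le_trans _ _ (`|h| ^+ 2)).
    rewrite real_normK ?num_real// ler_norml.
    by case: (ramp_cases (h + t)) => -[? ->]; case: (ramp_cases t) => -[? ->];
      apply/andP; split; nra.
  by rewrite expr2 ler_wpM2r//; near: h; exact: dnbhs0_le.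
apply: DeriveDef; first by apply: cvgP H.
exact: (cvg_lim (@norm_hausdorff _ _) H).
Unshelve. all: end_near. Qed.

Variables (r a : R).

(** A scaled second difference of [ramp]: the hat function on [[a, a + 2 * r]] with peak [1 / r] at
    [a + r], hence of integral 1. *)
Definition tent (t : R) : R :=
  (ramp (t - a) - 2 * ramp (t - a - r) + ramp (t - a - 2 * r)) / r ^+ 2.

(** The primitive of [tent] that rises from 0 to 1. As all steps have the same height, a difference
    of two of them vanishes at both ends of [times]. *)
Definition step (t : R) : R :=
  (ramp (t - a) ^+ 2 - 2 * ramp (t - a - r) ^+ 2 + ramp (t - a - 2 * r) ^+ 2)
    / (2 * r ^+ 2).

Hypothesis r0 : 0 < r.

Lemma is_derive_step (t : R) : is_derive t 1 step (tent t).
Proof.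
have shifted b : is_derive t 1 (fun t => ramp (t - b) ^+ 2) (2 * ramp (t - b)).
  rewrite -[2 * _]mulr1; apply: (@is_derive1_comp _ (fun t => ramp t ^+ 2) (fun t => t - b)).
    exact: is_derive_ramp_sqr.
  by apply: is_derive_eq; rewrite subr0.
have -> : step = (2 * r ^+ 2)^-1 \*: ((fun t => ramp (t - a) ^+ 2)
   - (2 : R) \*: (fun t => ramp (t - (a + r)) ^+ 2)
   + (fun t => ramp (t - (a + 2 * r)) ^+ 2)).
  by apply/funext => s; rewrite /step !fctE /GRing.scale/= !opprD !addrA mulrC.
apply: is_derive_eq; rewrite /tent !opprD !addrA /GRing.scale/=.
by field; rewrite gt_eqF.
Qed.

Lemma tent_ge0 t : 0 <= tent t.
Proof.
rewrite divr_ge0 ?sqr_ge0//.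
by case: (ramp_cases (t - a)) => -[? ->]; case: (ramp_cases (t - a - r)) => -[? ->];
  case: (ramp_cases (t - a - 2 * r)) => -[? ->]; lra.
Qed.

Lemma tent_neq0 t : tent t != 0 -> a <= t <= a + 2 * r.
Proof.
apply: contra_neqT; rewrite negb_and -!ltNge /tent => ht.
suff -> : ramp (t - a) - 2 * ramp (t - a - r) + ramp (t - a - 2 * r) = 0 by rewrite mul0r.
case: (ramp_cases (t - a)) => -[? ->]; case: (ramp_cases (t - a - r)) => -[? ->];
  case: (ramp_cases (t - a - 2 * r)) => -[? ->]; case/orP: ht => ?; have := r0; lra.
Qed.

Lemma tent_gt0 : 0 < tent (a + r).
Proof.
rewrite divr_gt0 ?exprn_gt0//.
case: (ramp_cases (a + r - a)) => -[? ->]; case: (ramp_cases (a + r - a - r)) => -[? ->];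
  case: (ramp_cases (a + r - a - 2 * r)) => -[? ->]; have := r0; lra.
Qed.

Lemma step_le0 t : t <= a -> step t = 0.
Proof.
move=> ta; rewrite /step.
suff -> : ramp (t - a) ^+ 2 - 2 * ramp (t - a - r) ^+ 2 + ramp (t - a - 2 * r) ^+ 2 = 0.
  by rewrite mul0r.
have := r0.
case: (ramp_cases (t - a)) => -[? ->]; case: (ramp_cases (t - a - r)) => -[? ->];
  case: (ramp_cases (t - a - 2 * r)) => -[? ->] ?; nra.
Qed.

Lemma step_ge1 t : a + 2 * r <= t -> step t = 1.
Proof.
move=> ta; rewrite /step /ramp !max_l; [|have := r0; lra..].
by field; rewrite gt_eqF.
Qed.

Lemma step_itv t : 0 <= step t <= 1.
Proof.
rewrite /step divr_ge0/=; last by rewrite mulr_ge0// sqr_ge0.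
  rewrite ler_pdivrMr ?mulr_gt0 ?exprn_gt0// mul1r; have := r0.
  case: (ramp_cases (t - a)) => -[? ->]; case: (ramp_cases (t - a - r)) => -[? ->];
  case: (ramp_cases (t - a - 2 * r)) => -[? ->] ?; nra.
have := r0.
case: (ramp_cases (t - a)) => -[? ->]; case: (ramp_cases (t - a - r)) => -[? ->];
  case: (ramp_cases (t - a - 2 * r)) => -[? ->] ?; nra.
Qed.

Lemma continuous_tent : continuous tent.
Proof.
have shifted b : continuous (fun t => ramp (t - b)).
  move=> t; apply: (@continuous_comp _ _ _ (fun t => t - b) ramp).
    by apply: cvgB; [exact: cvg_id|exact: cvg_cst].
  exact: continuous_ramp.
rewrite /tent => t; apply: cvgM; last exact: cvg_cst.
under eq_fun do rewrite -!addrA -!opprD.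
rewrite -!addrA -!opprD.
apply: cvgD; first exact: shifted.
apply: cvgD; last exact: shifted.
by apply: cvgN; apply: cvgM; [exact: cvg_cst|exact: shifted].
Qed.

End Test_functions.

(** * Comparing the values of a function at two times *)

Section Du_Bois_Reymond.
Context {R : realType}.

Lemma is_derive_continuous (F F' : R -> R) :
  (forall t : R, is_derive t 1 F (F' t)) -> continuous F.
Proof.
move=> dF t; apply: differentiable_continuous; apply/derivable1_diffP.
exact: ex_derive.
Qed.

Lemma Rintegral_times_derivative (F F' : R -> R) :
  (forall t : R, is_derive t 1 F (F' t)) -> continuous F' ->
  \int[lebesgue_measure]_(t in times) F' t = F 1 - F 0.
Proof.
move=> dF cF'; have cF := is_derive_continuous dF.
rewrite /Rintegral (@continuous_FTC2 _ _ F) ?ltr01//=.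
- exact: continuous_subspaceT.
- split => [t _||].
  + exact: ex_derive.
  + exact: cvg_at_right_filter (cF 0).
  + exact: cvg_at_left_filter (cF 1).
- by move=> t _; rewrite derive1E; have [] := dF t.
Qed.

(** Room for a tent next to [t], on its right when [t <= 1 / 2] and on its left otherwise, as [t]
    may be 0 or 1. All small [r] are allowed so that two tents can share one width. *)
Lemma tent_support (D : set R) (t : R) : times t -> (\forall s \near t, D s) ->
  exists2 d, 0 < d & forall r, 0 < r <= d -> exists a, [/\ 0 <= a, a + 2 * r <= 1 &
    forall s, a <= s <= a + 2 * r -> D s].
Proof.
move=> /=; rewrite /times/= in_itv/= => /andP[t0 t1] /nbhs_ballP[d /= d0 dD].
have D' s : `|t - s| < d -> D s by exact: dD.
(* A tent has width [2 * r], here at most [d / 2] and at most [1 / 2]: it stays in the ball and in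
   [times]. *)
exists (Num.min d 1 / 4); first by rewrite divr_gt0// lt_min d0/=.
move=> r /andP[r0]; rewrite ler_pdivlMr// le_min => /andP[rd r1].
have [t2|t2] := leP t (1 / 2).
  exists t; split => //; first by lra.
  by move=> s /andP[ts st]; apply: D'; rewrite ler0_norm; lra.
exists (t - 2 * r); split; [lra|lra|].
by move=> s /andP[ts st]; apply: D'; rewrite ger0_norm; lra.
Qed.

(** If the values differed, a tent near the larger one minus a tent near the smaller one would
    correlate strictly with [G]. The set [D] need not be connected, since [psi] lives on two
    separate pieces. *)
Lemma du_bois_reymond (D : set R) (G : R -> R) (t1 t2 : R) :
  open D -> continuous G -> times t1 -> times t2 -> D t1 -> D t2 ->
  (forall Psi psi : R -> R, (forall t : R, is_derive t 1 Psi (psi t)) ->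
    continuous psi -> (forall t, `|Psi t| <= 1) -> Psi 0 = 0 -> Psi 1 = 0 ->
    (forall t, psi t != 0 -> D t) ->
    \int[lebesgue_measure]_(t in times) (psi t * G t) = 0) ->
  G t1 = G t2.
Proof.
move=> oD cG; wlog Gt : t1 t2 / G t2 < G t1.
  move=> H tt1 tt2 Dt1 Dt2 orth.
  by have [G12|G12|//] := ltgtP (G t1) (G t2); [symmetry|]; exact: H.
move=> tt1 tt2 Dt1 Dt2 orth.
set c := (G t1 + G t2) / 2.
have c1 : \forall s \near t1, D s /\ c < G s.
  near=> s; split; near: s; first exact: open_nbhs_nbhs.
  by apply: (cvgr_gt (G t1) (cG t1)); rewrite /c; lra.
have c2 : \forall s \near t2, D s /\ G s < c.
  near=> s; split; near: s; first exact: open_nbhs_nbhs.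
  by apply: (cvgr_lt (G t2) (cG t2)); rewrite /c; lra.
(* The smaller of [d1] and [d2] serves as the common half-width of both tents. *)
have [d1 d1_gt0 /(_ (Num.min d1 _))] := tent_support tt1 c1.
have [d2 d2_gt0 /(_ (Num.min d1 d2))] := tent_support tt2 c2.
rewrite lt_min d1_gt0 d2_gt0 ge_min lexx orbT => /(_ isT)[a2 [a20 a21 Da2]].
move=> /(_ d2); rewrite lt_min d1_gt0 d2_gt0 ge_min lexx => /(_ isT)[a1 [a10 a11 Da1]].
set r := Num.min d1 d2 in a21 Da2 a11 Da1.
have r0 : 0 < r by rewrite lt_min d1_gt0.
pose Psi t := step r a1 t - step r a2 t.
pose psi t := tent r a1 t - tent r a2 t.
have dPsi (t : R) : is_derive t 1 Psi (psi t).
  by apply: is_deriveB; exact: is_derive_step.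
have cpsi : continuous psi.
  by move=> t; apply: cvgB; exact: continuous_tent.
have Psi1 : Psi 1 = 0 by rewrite /Psi !step_ge1// subrr.
have Psi0 : Psi 0 = 0 by rewrite /Psi !step_le0// subrr.
(* On the first tent both factors are positive, on the second both are negative; the tents cannot
   overlap, as [G] would be on both sides of [c]. *)
have sign t : 0 <= psi t * (G t - c) /\ (tent r a1 t != 0 -> 0 < psi t * (G t - c)).
  rewrite /psi; have := tent_ge0 r a1 t; have := tent_ge0 r a2 t.
  have [->|/[dup] T1 /(tent_neq0 r0)/Da1[_ G1]] := eqVneq (tent r a1 t) 0;
  have [->|/(tent_neq0 r0)/Da2[_ G2]] := eqVneq (tent r a2 t) 0 => h2 h1.
  - by rewrite subrr mul0r.
  - by split => //; nra.
  - rewrite subr0; split => [|_]; first by rewrite mulr_ge0//; lra.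
    by rewrite mulr_gt0 ?subr_gt0// lt_neqAle eq_sym T1.
  - by move: (lt_trans G1 G2); rewrite ltxx.
have orth_psi : \int[lebesgue_measure]_(t in times) (psi t * G t) = 0.
  apply: (orth Psi psi) => // t.
    have /andP[? ?] := step_itv a1 r0 t; have /andP[? ?] := step_itv a2 r0 t.
    by rewrite ler_norml /Psi; apply/andP; split; lra.
  rewrite /psi; have [->|/(tent_neq0 r0)/Da1[]//] := eqVneq (tent r a1 t) 0.
  by rewrite sub0r oppr_eq0 => /(tent_neq0 r0)/Da2[].
(* The constant [c] contributes nothing, because [psi] integrates to [Psi 1 - Psi 0 = 0]. *)
have int0 : \int[lebesgue_measure]_(t in times) (psi t * (G t - c)) = 0.
  under eq_Rintegral do rewrite mulrBr.
  rewrite RintegralB; first last.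
  - by apply: continuous_itv_integrable => t; apply: cvgM; [exact: cpsi|exact: cvg_cst].
  - by apply: continuous_itv_integrable; exact: continuous_mul.
  - exact: measurable_itv.
  rewrite orth_psi RintegralZr; [|exact: measurable_itv|exact: continuous_itv_integrable].
  by rewrite (Rintegral_times_derivative dPsi cpsi) Psi0 Psi1 subrr mul0r subr0.
have cg : continuous (fun t => psi t * (G t - c)).
  by apply: continuous_mul => // t; apply: cvgB; [exact: cG|exact: cvg_cst].
(* The peak of the first tent, where the integrand should vanish and yet is positive. *)
have a1r : times (a1 + r).
  by rewrite /times/= in_itv/=; apply/andP; split; lra.
have := Rintegral_eq0_continuous ltr01 cg (fun t _ => (sign t).1) int0 a1r.
have [_ /(_ _)] := sign (a1 + r).
by rewrite gt_eqF ?tent_gt0// => /(_ isT) /[swap] ->; rewrite ltxx.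
Unshelve. all: end_near. Qed.

End Du_Bois_Reymond.

(** * Normalized functions tested against bumps in the frequency *)

Section Fundamental_lemma.
Context {R : realType}.

Definition normalized (g : R -> R) (x : R) : R := (g x - mean g) / deviation g.

Lemma continuous_normalized g : continuous g -> continuous (normalized g).
Proof.
move=> cg x; apply: cvgM; last exact: cvg_cst.
by apply: cvgB; [exact: cg|exact: cvg_cst].
Qed.

(** Recognizes the coefficient of the first variation as the pairing of the normalized function with
    the test function. *)
Lemma mean_normalizedM (g h : R -> R) : continuous g -> continuous h ->
  mean (fun x => normalized g x * h x) = cov g h / deviation g.
Proof.
move=> cg ch.
have -> : mean (fun x => normalized g x * h x) =
    mean (fun x => (deviation g)^-1 * (g x * h x + - mean g * h x)).
  by apply: eq_mean => x _; rewrite /normalized; ring.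
have cgh := continuous_mul cg ch.
have cmh := @continuous_scale _ (- mean g) _ ch.
rewrite meanZ ?meanD ?meanZ//; last exact: continuous_add.
by rewrite /cov; ring.
Qed.

(** If [w x] were nonzero, a C^1 bump supported where [w] keeps the sign of [w x] would have a
    nonzero pairing with [w]. Multiplying by [w x] treats both signs at once. *)
Lemma mean_eq0_bump (w : R -> R) : continuous w ->
  (forall phi phi' : R -> R, (forall x : R, is_derive x 1 phi (phi' x)) ->
    continuous phi' -> (forall x, `|phi x| <= 1) ->
    mean (fun x => w x * phi x) = 0) ->
  forall x, freqs x -> w x = 0.
Proof.
move=> cw orth x xf; apply/eqP/negPn/negP => wx.
have w2 : 0 < w x * w x by rewrite -expr2 exprn_even_gt0.
have cww : continuous (fun y => w x * w y) by exact: continuous_scale.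
have /nbhs_ballP[d /= d0 wd] : \forall y \near x, 0 < w x * w y.
  exact: (cvgr_gt (w x * w x) (cww x)).
(* [r <= d] confines the bump to the ball, and [r <= 1] keeps it bounded by 1. *)
set r := Num.min d 1.
have r0 : 0 < r by rewrite lt_min d0/=.
have [rd r1] : r <= d /\ r <= 1 by rewrite !ge_min !lexx orbT.
pose u y : R := r ^+ 2 - (y - x) ^+ 2.
pose phi y := ramp (u y) ^+ 2.
pose phi' y := 2 * ramp (u y) * (- (2 * (y - x))).
have du (y : R) : is_derive y 1 u (- (2 * (y - x))).
  rewrite /u; apply: is_derive_eq.
  rewrite /GRing.scale/=. ring.
have dphi (y : R) : is_derive y 1 phi (phi' y).
  apply: (@is_derive1_comp _ (fun t => ramp t ^+ 2) u).
  exact: is_derive_ramp_sqr.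
have cu : continuous u by exact: is_derive_continuous du.
have cphi' : continuous phi'.
  apply: continuous_mul.
    apply: continuous_scale => y; apply: (@continuous_comp _ _ _ u); first exact: cu.
    exact: continuous_ramp.
  move=> y; apply: cvgN; apply: cvgM; first exact: cvg_cst.
  by apply: cvgB; [exact: cvg_id|exact: cvg_cst].
have u1 y : u y <= 1.
  by rewrite /u; have := sqr_ge0 (y - x); nra.
have phi1 y : `|phi y| <= 1.
  rewrite ger0_norm ?sqr_ge0// /phi expr_le1//.
    by rewrite /ramp ge_max u1/=.
  by rewrite /ramp le_max lexx orbT.
have := orth phi phi' dphi cphi' phi1 => mean0.
have cphi : continuous phi by exact: is_derive_continuous dphi.
have cg : continuous (fun y => w x * (w y * phi y)).
  by apply: continuous_scale; exact: continuous_mul.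
have g0 y : 0 <= w x * (w y * phi y).
  rewrite mulrA /phi /ramp; have [uy|uy] := leP (u y) 0; first by rewrite expr0n mulr0.
  rewrite mulr_ge0 ?sqr_ge0// ltW//; apply: wd; rewrite /ball/=.
  move: uy; rewrite /u subr_gt0 => yr.
  rewrite (lt_le_trans _ rd)// distrC -(ltr_pXn2r (n:=2)) ?nnegrE//; last exact: ltW.
  by rewrite real_normK ?num_real.
have pipi : - pi < pi :> R by rewrite gtrN ?pi_gt0.
have := Rintegral_eq0_continuous pipi cg (fun y _ => g0 y) _ xf.
have -> : \int[lebesgue_measure]_(y in `[(- pi), pi]) (w x * (w y * phi y)) = 0.
  rewrite RintegralZl//; last by apply: continuous_itv_integrable; exact: continuous_mul.
  move: mean0; rewrite /mean => /eqP; rewrite mulf_eq0 invr_eq0 gt_eqF ?pi2_gt0//=.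
  by move=> /eqP ->; rewrite mulr0.
move=> /(_ erefl)/eqP; rewrite mulrA mulf_eq0 gt_eqF//= /phi /u subrr expr0n subr0.
by rewrite /ramp max_l ?sqr_ge0// expf_eq0/= expf_eq0/= gt_eqF.
Qed.

End Fundamental_lemma.

(** * Derivatives within an interval *)

Section Derivative_within_calculus.
Context {R : realType}.
Implicit Types (A : set R) (g p : R -> R) (x d : R).

(** Every point of a nondegenerate interval, endpoints included, is a limit of other points of it;
    this makes the derivatives within it unique. *)
Lemma within_itv_proper (a b x : R) : a < b -> `[a, b]%classic x ->
  ProperFilter (within `[a, b] x^').
Proof.
move=> ab; rewrite /= in_itv/= => /andP[ax xb].
apply: Build_ProperFilter_ex => U /nbhs_ballP[d /= d0 dU].
have [xltb|bx] := ltP x b.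
  have m0 : 0 < Num.min (d / 2) (b - x) by rewrite lt_min divr_gt0//= subr_gt0.
  have md : Num.min (d / 2) (b - x) <= d / 2 by rewrite ge_min lexx.
  have mb : Num.min (d / 2) (b - x) <= b - x by rewrite ge_min lexx orbT.
  exists (x + Num.min (d / 2) (b - x)); apply: dU => /=.
  - by rewrite /ball/= opprD addNKr normrN gtr0_norm//; lra.
  - by apply/eqP => H; lra.
  - by rewrite in_itv/=; apply/andP; split; lra.
have m0 : 0 < Num.min (d / 2) (x - a).
  by rewrite lt_min divr_gt0//= subr_gt0 (lt_le_trans ab).
have md : Num.min (d / 2) (x - a) <= d / 2 by rewrite ge_min lexx.
have ma : Num.min (d / 2) (x - a) <= x - a by rewrite ge_min lexx orbT.
exists (x - Num.min (d / 2) (x - a)); apply: dU => /=.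
- by rewrite /ball/= opprD opprK addrA subrr add0r gtr0_norm//; lra.
- by apply/eqP => H; lra.
- by rewrite in_itv/=; apply/andP; split; lra.
Qed.

Lemma times_proper x : times x -> ProperFilter (within times x^').
Proof. exact: within_itv_proper ltr01. Qed.

Lemma freqs_proper x : freqs x -> ProperFilter (within freqs x^').
Proof. by apply: within_itv_proper; rewrite gtrN ?pi_gt0. Qed.

Definition is_derive_within A g x d : Prop := quotient_within A g x --> d.

Lemma derive_withinP A g x : derivable_within A g x ->
  is_derive_within A g x (derive_within A g x).
Proof. by []. Qed.

Lemma is_derive_within_derivable A g x d : is_derive_within A g x d ->
  derivable_within A g x.
Proof. exact: cvgP. Qed.

Lemma derive_withinE A g x d : ProperFilter (within A x^') ->
  is_derive_within A g x d -> derive_within A g x = d.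
Proof. by move=> PA gd; apply: (cvg_lim (@norm_hausdorff _ _) gd). Qed.

Lemma near_within_dnbhs A x (P : set R) : (forall y, A y -> y != x -> P y) ->
  within A x^' P.
Proof. by move=> AP; apply: (@filterE _ (nbhs x)) => y yx Ay; exact: AP. Qed.

Lemma is_derive_within_continuous A g x d : is_derive_within A g x d ->
  g y @[y --> within A x^'] --> g x.
Proof.
move=> gd.
have : (y - x) * ((y - x)^-1 * (g y - g x)) + g x @[y --> within A x^'] --> 0 * d + g x.
  apply: cvgD; last exact: cvg_cst.
  apply: cvgM; last exact: gd.
  rewrite -(subrr x); apply: cvgB; last exact: cvg_cst.
  by apply: cvg_trans (@nbhs_dnbhs _ x); exact: cvg_within.
rewrite mul0r add0r; apply: cvg_trans; apply: near_eq_cvg.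
by apply: near_within_dnbhs => y _ yx; field; rewrite subr_eq0.
Qed.

Lemma is_derive_withinM A g p x (g' p' : R) : is_derive_within A g x g' ->
  is_derive_within A p x p' ->
  is_derive_within A (fun y => g y * p y) x (g' * p x + g x * p').
Proof.
move=> gg' pp'.
have : (y - x)^-1 * (g y - g x) * p y + g x * ((y - x)^-1 * (p y - p x))
    @[y --> within A x^'] --> g' * p x + g x * p'.
  apply: cvgD; first by apply: cvgM; [exact: gg'|exact: is_derive_within_continuous pp'].
  by apply: cvgM; [exact: cvg_cst|exact: pp'].
apply: cvg_trans; apply: near_eq_cvg.
by apply: near_within_dnbhs => y _ _; ring.
Qed.

(** The change of variable [h = y - x] between two forms of the difference quotient. *)
Lemma is_derive_quotient p x d : is_derive x 1 p d ->
  (y - x)^-1 * (p y - p x) @[y --> x^'] --> d.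
Proof.
move=> [dp <-] U /dp; rewrite !near_simpl => /nbhs_ballP[e /= e0 eU].
apply/nbhs_ballP; exists e => //= y; rewrite /ball/= distrC => yx ynx.
have := eU (y - x); rewrite /ball/= sub0r normrN => /(_ yx).
by rewrite /= subr_eq0 => /(_ ynx); rewrite scaler1 subrK.
Qed.

Lemma is_derive_is_derive_within A p x d : is_derive x 1 p d -> is_derive_within A p x d.
Proof.
move=> /is_derive_quotient; apply: cvg_trans.
by apply: cvg_app; exact: cvg_within.
Qed.

Lemma is_derive_within_ln A g x d : 0 < g x -> is_derive_within A g x d ->
  is_derive_within A (fun y => ln (g y)) x (d / g x).
Proof.
move=> gx0 gd.
(* The slope of [ln] from [g x], extended continuously by its limit: the chain rule must not divide
   by [g y - g x], which may be 0. *)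
pose slope v := if v == g x then (g x)^-1 else (v - g x)^-1 * (ln v - ln (g x)).
have cslope : {for g x, continuous slope}.
  apply/continuous_withinNx; rewrite {2}/slope eqxx.
  apply: cvg_trans (is_derive_quotient (is_derive1_ln gx0)).
  apply: near_eq_cvg; near=> v; rewrite /slope ifF//; apply/negbTE.
  by near: v; exact: nbhs_dnbhs_neq.
have : slope (g y) * ((y - x)^-1 * (g y - g x)) @[y --> within A x^'] --> (g x)^-1 * d.
  apply: cvgM; last exact: gd.
  have := @cvg_comp _ _ _ g slope _ _ _ (is_derive_within_continuous gd) cslope.
  by rewrite {2}/slope eqxx.
rewrite mulrC; apply: cvg_trans; apply: near_eq_cvg.
apply: near_within_dnbhs => y _ yx; rewrite /slope; case: ifPn => [/eqP ->|gyx].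
  by rewrite !subrr !mulr0.
by field; rewrite !subr_eq0 gyx yx.
Unshelve. all: end_near. Qed.

End Derivative_within_calculus.

(** * Admissible variations *)

Section Square_integrable.
Context {R : realType}.
Implicit Types g h p : R -> R.

Lemma eq_square_integrable g h : (forall x, freqs x -> g x = h x) ->
  square_integrable g -> square_integrable h.
Proof.
move=> gh [mg ig]; split.
  by apply: eq_measurable_fun mg => x /set_mem; exact: gh.
apply: eq_integrable ig; first exact: measurable_itv.
by move=> x /set_mem xf /=; rewrite gh.
Qed.

(** A continuous [p] is bounded on the compact [freqs]. *)
Lemma square_integrableM g p : square_integrable g -> continuous p ->
  square_integrable (fun x => g x * p x).
Proof.
move=> [mg ig] cp.
have mgp : measurable_fun freqs (fun x => g x * p x).
  apply: measurable_funM => //; apply: measurable_funTS.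
  exact: continuous_measurable_fun.
split=> //.
have [K _ pK] := plane_continuous_bounded (plane_continuous_snd cp).
have ig' : lebesgue_measure.-integrable freqs (fun x => ((K ^+ 2)%:E * (g x ^+ 2)%:E)%E).
  by apply: integrableZl => //; exact: measurable_itv.
apply: le_integrable ig' => /=.
- exact: measurable_itv.
- by apply/measurable_EFinP; exact: measurable_funX.
- move=> x xf; rewrite lee_fin ger0_norm ?sqr_ge0// ger0_norm; last first.
    by rewrite mulr_ge0 ?sqr_ge0.
  rewrite exprMn mulrC ler_wpM2r ?sqr_ge0// -[p x ^+ 2]real_normK ?num_real//.
  have pxK : `|p x| <= K by apply: (pK 0 x _ xf); rewrite /times/= in_itv/= lexx ler01.
  by rewrite lerXn2r ?nnegrE// (le_trans _ pxK).
Qed.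

(** The square of the sum is dominated by [2 * g x ^+ 2 + 2 * h x ^+ 2]. *)
Lemma square_integrableD g h : square_integrable g -> square_integrable h ->
  square_integrable (fun x => g x + h x).
Proof.
move=> [mg ig] [mh ih].
have mgh : measurable_fun freqs (fun x => g x + h x) by exact: measurable_funD.
split=> //.
have igh : lebesgue_measure.-integrable freqs
    ((fun x => 2%:E * (g x ^+ 2)%:E) \+ (fun x => 2%:E * (h x ^+ 2)%:E))%E.
  apply: integrableD; first exact: measurable_itv.
    by apply: integrableZl => //; exact: measurable_itv.
  by apply: integrableZl => //; exact: measurable_itv.
apply: le_integrable igh => /=.
- exact: measurable_itv.
- by apply/measurable_EFinP; exact: measurable_funX.
- move=> x xf; rewrite lee_fin !ger0_norm ?sqr_ge0//.
    by have := sqr_ge0 (g x - h x); nra.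
  by rewrite addr_ge0// mulr_ge0// sqr_ge0.
Qed.

Lemma differentiable_L2M g p (p' : R -> R) : differentiable_L2 g ->
  (forall x : R, is_derive x 1 p (p' x)) -> continuous p' ->
  differentiable_L2 (fun x => g x * p x).
Proof.
move=> [dg ig idg] dp cp'.
have cp := is_derive_continuous dp.
have dgp x : freqs x -> is_derive_within freqs (fun x => g x * p x) x
    (derive_within freqs g x * p x + g x * p' x).
  move=> xf; apply: is_derive_withinM; first exact: derive_withinP (dg x xf).
  exact: is_derive_is_derive_within.
split.
- by move=> x xf; exact: is_derive_within_derivable (dgp x xf).
- exact: square_integrableM.
- apply: (@eq_square_integrable
    (fun x => derive_within freqs g x * p x + g x * p' x)); last first.
    by apply: square_integrableD; exact: square_integrableM.
  by move=> x xf; rewrite (derive_withinE (freqs_proper xf) (dgp x xf)).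
Qed.

End Square_integrable.

(** * Families multiplied by a factor affine in a product [Psi t * phi x] *)

Section Multiplied_family.
Context {R : realType}.
Variables (phi phi' Psi psi : R -> R).
Hypothesis dphi : forall x : R, is_derive x 1 phi (phi' x).
Hypothesis cphi' : continuous phi'.
Hypothesis dPsi : forall t : R, is_derive t 1 Psi (psi t).
Hypothesis cpsi : continuous psi.

(** Two constants let one set of lemmas cover both uses: [0] and [1] give the variation, [1] and [e]
    the varied path. *)
Definition mul_family (c0 c1 : R) (f : R -> R -> R) (t x : R) : R :=
  f t x * (c0 + c1 * (Psi t * phi x)).

Lemma eq_jointly_continuous (F G : R -> R -> R) :
  (forall t x, times t -> freqs x -> F t x = G t x) ->
  jointly_continuous F -> jointly_continuous G.
Proof.
move=> FG; apply: subspace_eq_continuous => -[t x] /set_mem[/= tt xf].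
exact: FG.
Qed.

Lemma jointly_continuousM (F G : R -> R -> R) : jointly_continuous F ->
  jointly_continuous G -> jointly_continuous (fun t x => F t x * G t x).
Proof. by move=> cF cG p; apply: cvgM; [exact: cF|exact: cG]. Qed.

Lemma jointly_continuousD (F G : R -> R -> R) : jointly_continuous F ->
  jointly_continuous G -> jointly_continuous (fun t x => F t x + G t x).
Proof. by move=> cF cG p; apply: cvgD; [exact: cF|exact: cG]. Qed.

Lemma plane_jointly_continuous (F : R -> R -> R) :
  plane_continuous F -> jointly_continuous F.
Proof. exact: continuous_subspaceT. Qed.

Variables (c0 c1 : R) (f : R -> R -> R).
Hypothesis smooth_f : smooth_family f.

Lemma is_derive_mul_family t x : times t -> freqs x ->
  is_derive_within times (fun s => mul_family c0 c1 f s x) t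
    (dtau f t x * (c0 + c1 * (Psi t * phi x)) + f t x * (c1 * (psi t * phi x))).
Proof.
move=> tt xf; have [df _ _] := smooth_f.
apply: (is_derive_withinM (g := fun s => f s x)).
  exact: derive_withinP (df t x tt xf).
apply: is_derive_is_derive_within.
have -> : (fun s => c0 + c1 * (Psi s * phi x)) = cst c0 + (c1 * phi x) \*: Psi.
  by apply/funext => s; rewrite !fctE /= /GRing.scale/=; ring.
by apply: is_derive_eq; rewrite /GRing.scale/=; ring.
Qed.

Lemma dtau_mul_family t x : times t -> freqs x ->
  dtau (mul_family c0 c1 f) t x =
  dtau f t x * (c0 + c1 * (Psi t * phi x)) + f t x * (c1 * (psi t * phi x)).
Proof.
move=> tt xf.
exact: (derive_withinE (times_proper tt) (is_derive_mul_family tt xf)).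
Qed.

Lemma plane_continuous_multiplier (u v : R -> R) : continuous u -> continuous v ->
  plane_continuous (fun t x => c0 + c1 * (u t * v x)).
Proof.
move=> cu cv; apply: plane_continuousD; first by move=> p; exact: cvg_cst.
apply: plane_continuousZ; apply: plane_continuousM.
  exact: plane_continuous_fst.
exact: plane_continuous_snd.
Qed.

Lemma smooth_mul_family : smooth_family (mul_family c0 c1 f).
Proof.
have [df cf cdf] := smooth_f.
have cphi := is_derive_continuous dphi; have cPsi := is_derive_continuous dPsi.
split.
- by move=> t x tt xf; exact: is_derive_within_derivable (is_derive_mul_family tt xf).
- apply: jointly_continuousM => //; apply: plane_jointly_continuous.
  exact: plane_continuous_multiplier.
- apply: (@eq_jointly_continuous (fun t x =>
    dtau f t x * (c0 + c1 * (Psi t * phi x)) + f t x * (c1 * (psi t * phi x)))).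
    by move=> t x tt xf; rewrite dtau_mul_family.
  apply: jointly_continuousD; apply: jointly_continuousM => //;
    apply: plane_jointly_continuous; first exact: plane_continuous_multiplier.
  apply: plane_continuousZ; apply: plane_continuousM.
    exact: plane_continuous_fst.
  exact: plane_continuous_snd.
Qed.

Lemma differentiable_L2_mul_family t : differentiable_L2 (f t) ->
  differentiable_L2 (mul_family c0 c1 f t).
Proof.
move=> df; apply: (differentiable_L2M (p' := fun x => c1 * Psi t * phi' x)) => //.
  move=> x.
  have -> : (fun x => c0 + c1 * (Psi t * phi x)) = cst c0 + (c1 * Psi t) \*: phi.
    by apply/funext => s; rewrite !fctE /= /GRing.scale/=; ring.
  by apply: is_derive_eq; rewrite /GRing.scale/=; ring.
exact: continuous_scale.
Qed.

End Multiplied_family.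

(** * Extremal paths *)

Section Clamped_speed.
Context {R : realType}.

Definition clamp (a b x : R) : R := Num.max a (Num.min b x).

Lemma clamp_id a b x : `[a, b]%classic x -> clamp a b x = x.
Proof. by rewrite /= in_itv/= => /andP[ax xb]; rewrite /clamp min_r// max_r. Qed.

Lemma clamp_itv a b x : a <= b -> `[a, b]%classic (clamp a b x).
Proof.
move=> ab; rewrite /clamp /= in_itv/= le_max lexx/= ge_max ab/=.
by rewrite ge_min lexx.
Qed.

Lemma continuous_clamp a b : continuous (clamp a b).
Proof.
move=> x; apply: (@continuous_max _ _ (fun=> a) (fun y => Num.min b y)).
  exact: cvg_cst.
by apply: (@continuous_min _ _ (fun=> b) id); [exact: cvg_cst|exact: cvg_id].
Qed.

(* Extends F from times x freqs to the plane, which turns continuity within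
   the rectangle into plain continuity. *)
Definition clamped (F : R -> R -> R) (t x : R) : R :=
  F (clamp 0 1 t) (clamp (- pi) pi x).

Lemma clampedE F t x : times t -> freqs x -> clamped F t x = F t x.
Proof. by move=> tt xf; rewrite /clamped !clamp_id. Qed.

(** Clamping is a continuous map of the plane into the rectangle, within which [F] is continuous. *)
Lemma plane_continuous_clamped F : jointly_continuous F ->
  plane_continuous (clamped F).
Proof.
move=> /subspace_continuousP cF p.
pose k (q : R * R) := (clamp 0 1 q.1, clamp (- pi) pi q.2).
have kS q : (times `*` freqs) (k q).
  by split; apply: clamp_itv; rewrite ?ler01// ge0_cp// pi_ge0.
have ck : k q @[q --> p] --> k p.
  have c1 : clamp 0 1 q.1 @[q --> p] --> clamp 0 1 p.1.
    by apply: (@continuous_comp _ _ _ fst (clamp 0 1)); [exact: cvg_fst|exact: continuous_clamp].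
  have c2 : clamp (- pi) pi q.2 @[q --> p] --> clamp (- pi) pi p.2.
    by apply: (@continuous_comp _ _ _ snd (clamp (- pi) pi)); [exact: cvg_snd|exact: continuous_clamp].
  exact: (cvg_pair c1 c2).
move=> U /(cF _ (kS p)) /= /ck; rewrite /= !near_simpl.
by apply: filterS => q; apply; exact: kS.
Qed.

Definition speed (f : R -> R -> R) (t x : R) : R := dtau f t x / f t x.

Lemma jointly_continuous_speed f : smooth_family f ->
  (forall t x, times t -> freqs x -> 0 < f t x) -> jointly_continuous (speed f).
Proof.
move=> [_ /subspace_continuousP cf /subspace_continuousP cdf] f0.
apply/subspace_continuousP => -[t x] /[dup] -[/= tt xf] txS.
apply: cvgM; first exact: (cdf (t, x) txS).
by apply: cvgV; [rewrite gt_eqF// f0|exact: (cf (t, x) txS)].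
Qed.

Lemma dtau_log_path f t x : smooth_family f -> 0 < f t x -> times t -> freqs x ->
  dtau (log_path f) t x = speed f t x.
Proof.
move=> [df _ _] f0 tt xf; apply: (derive_withinE (times_proper tt)).
apply: (is_derive_within_ln (g := fun s => f s x)) => //.
exact: derive_withinP (df t x tt xf).
Qed.

Lemma eq_deviation (g h : R -> R) : (forall x, freqs x -> g x = h x) ->
  deviation g = deviation h.
Proof. by move=> gh; rewrite !deviationE (eq_cov gh gh). Qed.

End Clamped_speed.

(** * Vanishing first variation and constancy of the normalized speed *)

Section Extremal_paths.
Context {R : realType}.
Variables (f0 f1 : R -> R) (f : R -> R -> R).
Hypothesis extremal_f : extremal_path f0 f1 f.

Let smooth_f : smooth_family f. Proof. by have [[]] := extremal_f. Qed.

Let f_gt0 t x : times t -> freqs x -> 0 < f t x.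
Proof. by move=> tt xf; have [[_ /(_ t tt)[_ /(_ x xf)]]] := extremal_f. Qed.

Let A := clamped (speed f).

Lemma plane_continuous_clamped_speed : plane_continuous A.
Proof. by apply: plane_continuous_clamped; exact: jointly_continuous_speed. Qed.

Section Test.
Variables (phi phi' Psi psi : R -> R).
Hypothesis dphi : forall x : R, is_derive x 1 phi (phi' x).
Hypothesis cphi' : continuous phi'.
Hypothesis phi1 : forall x, `|phi x| <= 1.
Hypothesis dPsi : forall t : R, is_derive t 1 Psi (psi t).
Hypothesis cpsi : continuous psi.
Hypothesis Psi1 : forall t, `|Psi t| <= 1.
Hypothesis Psi_0 : Psi 0 = 0.
Hypothesis Psi_1 : Psi 1 = 0.

Let h := mul_family phi Psi 0 1 f.

Lemma add_mul_family e : (fun t x => f t x + e * h t x) = mul_family phi Psi 1 e f.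
Proof. by apply/funext => t; apply/funext => x; rewrite /h /mul_family; ring. Qed.

(** The logarithmic derivative of a product is a sum, so the factor [1 + e * (Psi t * phi x)] adds
    its own logarithmic derivative to the speed. *)
Lemma path_length_variation e : `|e| <= 1 / 2 ->
  path_length (fun t x => f t x + e * h t x) =
  \int[lebesgue_measure]_(t in times)
    deviation (fun x => A t x + e * (psi t * phi x / (1 + e * (Psi t * phi x)))).
Proof.
move=> e2; rewrite add_mul_family; apply: eq_Rintegral => t /set_mem tt.
apply: eq_deviation => x xf.
rewrite (dtau_mul_family _ dPsi) // /A clampedE// /speed /mul_family.
have ft : f t x != 0 by rewrite gt_eqF// f_gt0.
have m0 : 1 + e * (Psi t * phi x) != 0.
  by rewrite gt_eqF// (lt_le_trans _ (multiplier_ge e2 (Psi1 t) (phi1 x))).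
by field; rewrite m0 ft.
Qed.

Lemma path_between_variation e : `|e| <= 1 / 2 ->
  path_between f0 f1 (fun t x => f t x + e * h t x).
Proof.
move=> e2; have [[_ df fE0 fE1] _] := extremal_f; split.
- rewrite add_mul_family; exact: (smooth_mul_family dphi dPsi cpsi).
- move=> t tt; split.
    suff : differentiable_L2 (mul_family phi Psi 1 e f t) by rewrite -add_mul_family.
    by apply: (differentiable_L2_mul_family Psi dphi cphi'); have [] := df t tt.
  move=> x xf; suff : 0 < mul_family phi Psi 1 e f t x by rewrite -add_mul_family.
  rewrite mulr_gt0 ?f_gt0//.
  by rewrite (lt_le_trans _ (multiplier_ge e2 (Psi1 t) (phi1 x))).
- by move=> x xf; rewrite fE0// /h /mul_family Psi_0; ring.
- by move=> x xf; rewrite fE1// /h /mul_family Psi_1; ring.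
Qed.

Lemma admissible_variation_test : admissible_variation h.
Proof.
have [[_ df _ _] _] := extremal_f; split.
- exact: (smooth_mul_family dphi dPsi cpsi).
- by move=> t tt; apply: (differentiable_L2_mul_family Psi dphi cphi'); have [] := df t tt.
- by move=> x xf; rewrite /h /mul_family Psi_0; ring.
- by move=> x xf; rewrite /h /mul_family Psi_1; ring.
Qed.

(** Both [h] and [dtau h] are bounded on the compact rectangle, so the C^1 distance is of order
    [e]. *)
Lemma near_C1_close_variation eps : 0 < eps ->
  \forall e \near (0 : R), C1_close eps f (fun t x => f t x + e * h t x).
Proof.
move=> eps0; have [_ ch cdh] := smooth_mul_family dphi dPsi cpsi 0 1 smooth_f.
have [M M0 hM] := jointly_continuous_bounded ch.
have [N N0 dhN] := jointly_continuous_bounded cdh.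
have MN0 : 0 < M + N + 1 by lra.
have : \forall e \near (0 : R), `|e| < eps / (M + N + 1).
  by apply: nbhs0_lt; rewrite divr_gt0.
apply: filterS => e; rewrite ltr_pdivlMr// => eMN t x tt xf.
have small k : `|k| <= M + N -> `|e * k| < eps.
  move=> kMN; rewrite normrM (le_lt_trans _ eMN)// ler_wpM2l//.
  by rewrite (le_trans kMN)// lerDl.
split.
  rewrite addrAC subrr add0r small// (le_trans (hM t x tt xf))// lerDl; exact: ltW.
have -> : dtau (fun t x => f t x + e * h t x) t x - dtau f t x = e * dtau h t x.
  by rewrite add_mul_family !(dtau_mul_family _ dPsi)//; ring.
by rewrite small// (le_trans (dhN t x tt xf))// lerDr ltW.
Qed.

Lemma vanishing_first_variation n0 : 0 < n0 ->
  (forall t, times t -> psi t != 0 -> n0 <= deviation (A t)) ->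
  \int[lebesgue_measure]_(t in times)
    (psi t * (cov (A t) phi / Num.max n0 (deviation (A t)))) = 0.
Proof.
move=> n0_gt0 n0A.
have cA := plane_continuous_clamped_speed.
have cphi := is_derive_continuous dphi; have cPsi := is_derive_continuous dPsi.
have [C expansion] := first_variation cA cphi cpsi cPsi phi1 Psi1 n0_gt0 n0A.
set I := (X in X = 0).
pose L e := path_length (fun t x => f t x + e * h t x).
have L0 : L 0 = path_length f.
  by congr path_length; apply/funext => t; apply/funext => x; rewrite mul0r addr0.
have LI e : `|e| <= 1 / 2 -> `|L e - L 0 - e * I| <= C * e ^+ 2.
  move=> e2; rewrite /L !path_length_variation ?normr0//.
  rewrite [X in _ - X - _](_ : _ = \int[lebesgue_measure]_(t in times) deviation (A t)).
    exact: expansion.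
  apply: eq_Rintegral => t _; congr deviation; apply/funext => x.
  by rewrite mul0r addr0.
have near_half : \forall e \near (0 : R), `|e| <= 1 / 2 by exact: nbhs0_le.
have [_ [[eps eps0 fmin]|[eps eps0 fmax]|stat]] := extremal_f.
(* For small [e] the varied path is an admissible competitor: a path with the same endpoints, C^1
   close to [f]. *)
- apply: (expansion_min LI); near=> e; rewrite L0; apply: fmin.
    by apply: path_between_variation; near: e.
  by near: e; exact: near_C1_close_variation.
- apply: (expansion_max LI); near=> e; rewrite L0; apply: fmax.
    by apply: path_between_variation; near: e.
  by near: e; exact: near_C1_close_variation.
- exact: expansion_stationary LI (stat h admissible_variation_test).
Unshelve. all: end_near. Qed.

End Test.

Lemma normalized_speed_constant t1 t2 x : times t1 -> times t2 -> freqs x ->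
  deviation (A t1) != 0 -> deviation (A t2) != 0 ->
  normalized (A t1) x = normalized (A t2) x.
Proof.
move=> tt1 tt2 xf N1 N2.
have cA := plane_continuous_clamped_speed.
have cN := continuous_deviation cA.
have cn t : continuous (normalized (A t)).
  by apply: continuous_normalized; exact: plane_continuous_slice.
have dev_gt0 t : deviation (A t) != 0 -> 0 < deviation (A t).
  by move=> Nt; rewrite lt_neqAle eq_sym Nt sqrtr_ge0.
(* Halving makes both inequalities strict: [t1] and [t2] lie in the open set where the deviation
   exceeds [n0], and there the truncation is inactive. *)
pose n0 := Num.min (deviation (A t1)) (deviation (A t2)) / 2.
have n0_gt0 : 0 < n0 by rewrite divr_gt0// lt_min !dev_gt0.
have n01 : n0 < deviation (A t1).
  have := dev_gt0 _ N1; have : n0 * 2 <= deviation (A t1) by rewrite divfK// ge_min lexx.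
  lra.
have n02 : n0 < deviation (A t2).
  have := dev_gt0 _ N2; have : n0 * 2 <= deviation (A t2) by rewrite divfK// ge_min lexx orbT.
  lra.
apply/eqP; rewrite -subr_eq0; apply/eqP.
apply: (@mean_eq0_bump _ (fun y => normalized (A t1) y - normalized (A t2) y)) => //.
  by move=> y; apply: cvgB; exact: cn.
move=> phi phi' dphi cphi' phi1.
have cphi := is_derive_continuous dphi.
pose G t := cov (A t) phi / Num.max n0 (deviation (A t)).
have cG : continuous G.
  apply: continuous_mul.
    by apply: (continuous_cov cA); exact: plane_continuous_snd.
  move=> t; apply: cvgV; first by rewrite gt_eqF// lt_max n0_gt0.
  by apply: (@continuous_max _ _ (fun=> n0) _ t); [exact: cvg_cst|exact: cN].
have : G t1 = G t2.
  apply: (@du_bois_reymond _ [set t | n0 < deviation (A t)]) => //.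
    by apply: (@open_comp _ _ _ [set y | n0 < y]); [move=> t _; exact: cN|exact: open_gt].
  move=> Psi psi dPsi cpsi Psi1 Psi_0 Psi_1 supp.
  apply: (vanishing_first_variation dphi cphi' phi1 dPsi cpsi) => // t _ /supp/=.
  exact: ltW.
rewrite /G !max_r ?(ltW n01) ?(ltW n02)// => G12.
under eq_mean do rewrite mulrBl.
have cnphi t : continuous (fun y => normalized (A t) y * phi y) by exact: continuous_mul.
under eq_mean do rewrite -mulN1r.
rewrite meanD//; last exact: continuous_scale.
by rewrite meanZ// !mean_normalizedM ?G12 ?mulN1r ?subrr//; exact: plane_continuous_slice.
Qed.

End Extremal_paths.

Unset Implicit Arguments.

Theorem proposition6 (R : realType) (f0 f1 : R -> R)
    (hf0 : spectral_density f0) (hf1 : spectral_density f1)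
    (f : R -> R -> R) (hf : extremal_path f0 f1 f) :
  let xdot := dtau (log_path f) in
  exists v : R -> R, forall tau : R, times tau ->
    deviation (xdot tau) != 0 ->
    forall theta : R, freqs theta ->
      (xdot tau theta - mean (xdot tau)) / deviation (xdot tau) = v theta.
Proof.
move=> xdot; pose A := clamped (speed f).
have xdotE tau theta : times tau -> freqs theta -> xdot tau theta = A tau theta.
  move=> tt xf; have [[sf df _ _] _] := hf; have [_ f_gt0] := df _ tt.
  by rewrite /A clampedE// /xdot dtau_log_path// f_gt0.
have devE tau : times tau -> deviation (xdot tau) = deviation (A tau).
  by move=> tt; apply: eq_deviation => theta; exact: xdotE.
have normE tau theta : times tau -> freqs theta ->
    (xdot tau theta - mean (xdot tau)) / deviation (xdot tau) = normalized (A tau) theta.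
  move=> tt xf; rewrite /normalized xdotE// devE// (@eq_mean _ _ (A tau))//.
  by move=> x; exact: xdotE.
(* Any time of nonzero deviation serves as reference for [v]; if there is none, the claim is
   vacuous. *)
have [[t0 [tt0 dev0]]|no] := pselect (exists t0, times t0 /\ deviation (A t0) != 0).
  exists (normalized (A t0)) => tau tt dev theta xf; rewrite normE//.
  by apply: (normalized_speed_constant hf) => //; rewrite -devE.
by exists (fun=> 0) => tau tt dev; case: no; exists tau; rewrite -devE.
Qed.
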